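(* Let $G$ be a connected graph with maximum degree $\Delta$. Then, for any $\alpha\in[0,1]$, $$\lambda_1(B_\alpha(G))\le\begin{cases}(2-3\alpha)\,\Delta & \text{if }\alpha\in[0,\tfrac12],\\ \alpha\,\Delta & \text{if }\alpha\in(\tfrac12,1].\end{cases}$$
   Context: All graphs are simple and undirected, with a finite vertex set. $A(G)$ is the adjacency matrix, $D(G)$ the diagonal matrix of vertex degrees, and $L(G)=D(G)-A(G)$ the Laplacian matrix of $G$. For $\alpha\in[0,1]$, $B_\alpha(G):=\alpha A(G)+(1-\alpha)L(G)$. $\lambda_1(S)$ denotes the largest eigenvalue of a real symmetric matrix $S$. *)

(* Defs.v *)
From HB Require Import structures.
From mathcomp Require Import all_boot all_order all_algebra.
From mathcomp Require Import classical_sets reals.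
From mathcomp Require Import complex polyrcf.

Set Implicit Arguments.
Unset Strict Implicit.
Unset Printing Implicit Defensive.

Import Order.TTheory GRing.Theory Num.Theory.
Local Open Scope ring_scope.

Record sgraph := SGraph {
  vertex :> finType;
  adj : rel vertex;
  adj_sym : symmetric adj;
  adj_irr : irreflexive adj }.

Definition deg (G : sgraph) (x : G) : nat := #|[set y | adj x y]|.

Definition max_degree (G : sgraph) : nat := \max_(x : G) deg x.

(* By convention a connected graph has at least one vertex. *)
Definition connected_graph (G : sgraph) : Prop :=
  (0 < #|G|)%N /\ forall x y : G, connect (@adj G) x y.

Section GraphMatrices.
Variables (R : realType) (G : sgraph).

Definition adj_mx : 'M[R]_#|G| :=
  \matrix_(i, j) (adj (enum_val i) (enum_val j))%:R.

Definition deg_mx : 'M[R]_#|G| := diag_mx (\row_i (deg (enum_val i))%:R).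

Definition laplacian_mx : 'M[R]_#|G| := deg_mx - adj_mx.

Definition Balpha (alpha : R) : 'M[R]_#|G| :=
  alpha *: adj_mx + (1 - alpha) *: laplacian_mx.

End GraphMatrices.

(* For S symmetric with n > 0 this supremum is attained: see [lambda1P]. *)
Definition lambda1 (R : realType) (n : nat) (S : 'M[R]_n) : R :=
  sup [set x : R | eigenvalue S x]%classic.

Lemma Balpha_sym (R : realType) (G : sgraph) (alpha : R) :
  (Balpha G alpha)^T = Balpha G alpha.
Proof.
have symA : (adj_mx R G)^T = adj_mx R G.
  by apply/matrixP => i j; rewrite !mxE adj_sym.
rewrite /Balpha /laplacian_mx linearD !linearZ /= linearB /= symA.
by rewrite /deg_mx tr_diag_mx.
Qed.

Lemma sym_eigenvalue_exists (R : rcfType) (n : nat) (S : 'M[R]_n) :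
  (0 < n)%N -> S^T = S -> exists x, eigenvalue S x.
Proof.
move=> n_gt0 symS; pose f := real_complex R; pose M := map_mx f S.
have [z] : exists z, root (char_poly M) z.
  apply/closed_rootP; rewrite size_char_poly; by case: n n_gt0 {S symS M}.
rewrite -eigenvalue_root_char => /eigenvalueP[v vM v_neq0].
pose w := map_mx (@conjc R) v.
have wM : w *m M = conjc z *: w.
  rewrite -map_mxZ -vM map_mxM; congr (_ *m _).
  by apply/matrixP => i j; rewrite !mxE [RHS](conjc_real (S i j)).
have MT : M^T = M by rewrite -[RHS]/(map_mx f S) -[in RHS]symS; apply/matrixP => i j; rewrite !mxE.
have wz : z *: (v *m w^T) = conjc z *: (v *m w^T).
  rewrite scalemxAl -vM -mulmxA -{1}MT -trmx_mul wM.
  by rewrite linearZ /= -scalemxAr.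
have nz : (v *m w^T) 0 0 != 0.
  have [j vj] : exists j, v 0 j != 0 by apply/rV0Pn.
  rewrite mxE (bigD1 j) //= !mxE.
  rewrite gt_eqF // ltr_wpDr ?sumr_ge0 //.
    by move=> i _; rewrite !mxE -[conjc _]/(Num.conj _) mul_conjC_ge0.
  by rewrite -[conjc _]/(Num.conj _) mul_conjC_gt0.
have zc : z = conjc z.
  by apply: (mulIf nz); move/matrixP/(_ 0 0): wz; rewrite !mxE.
have zr : z = f (complex.Re z).
  case: z zc {vM wM wz} => a b [] /eqP; rewrite -addr_eq0 -mulr2n mulrn_eq0 /=.
  by move/eqP => ->.
exists (complex.Re z); rewrite eigenvalue_root_char -(fmorph_root f).
rewrite map_char_poly -[X in root _ X]/(f (complex.Re z)) -zr.
rewrite -[map_mx _ _]/M -eigenvalue_root_char.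
by apply/eigenvalueP; exists v.
Qed.

Lemma lambda1P (R : realType) (n : nat) (S : 'M[R]_n) :
  (0 < n)%N -> S^T = S ->
  eigenvalue S (lambda1 S) /\ forall x, eigenvalue S x -> x <= lambda1 S.
Proof.
move=> n_gt0 /(sym_eigenvalue_exists n_gt0)[x0 x0S].
have p0 : char_poly S != 0 by rewrite monic_neq0 ?char_poly_monic.
have memE x : eigenvalue S x = (x \in rootsR (char_poly S)).
  by rewrite eigenvalue_root_char -roots_on_rootsR // inE /=.
pose m := \big[Num.max/x0]_(x <- rootsR (char_poly S)) x.
have mS : eigenvalue S m.
  rewrite /m big_seq; apply: (big_ind (fun x => eigenvalue S x)) => //.
    by move=> x y xS yS; rewrite /Num.max; case: ifP.
  by move=> x; rewrite -memE.
have mub x : eigenvalue S x -> x <= m by rewrite memE => xs; exact: le_bigmax_seq.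
suff -> : lambda1 S = m by [].
apply/eqP; rewrite eq_le; apply/andP; split.
  by apply: ge_sup => //; exists x0.
by apply: ub_le_sup => //; exists m.
Qed.

(* Main.v *)
Require Import Defs.
From mathcomp Require Import all_boot all_order all_algebra.
From mathcomp Require Import reals.
From mathcomp Require Import lra.
Import Order.TTheory GRing.Theory Num.Theory.
Local Open Scope ring_scope.

(** The matrix is [(1 - alpha) D + (2 alpha - 1) A], so the absolute values in
    the column of a vertex of degree [d] sum to
    [((1 - alpha) + `|2 alpha - 1|) d]. No eigenvalue exceeds the largest
    absolute column sum ([norm_eigenvalue_le_col_sum]), hence the largest is at
    most [((1 - alpha) + `|2 alpha - 1|) Delta]. The sign of [2 alpha - 1] gives
    the two cases: the factor is [2 - 3 alpha] up to one half, [alpha] after. *)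

(** Gershgorin's argument: read the eigenvector equation at a coordinate of
    largest absolute value, and divide by that value. *)
Lemma norm_eigenvalue_le_col_sum (R : realFieldType) (n : nat) (S : 'M[R]_n)
    (c x : R) :
  (forall j, \sum_i `|S i j| <= c) -> eigenvalue S x -> `|x| <= c.
Proof.
move=> colS /eigenvalueP[v vS /rV0Pn[k vk_neq0]].
case: (@arg_maxP _ _ _ k predT (fun i => `|v 0 i|)) => // j _ vj_max.
have vj_gt0 : 0 < `|v 0 j|.
  by apply: lt_le_trans (vj_max k isT); rewrite normr_gt0.
rewrite -(ler_pM2r vj_gt0) -normrM.
have -> : x * v 0 j = \sum_i v 0 i * S i j.
  by move/matrixP/(_ 0 j): vS; rewrite !mxE.
apply: le_trans (ler_norm_sum _ _ _) _.
apply: le_trans (ler_wpM2r (ltW vj_gt0) (colS j)).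
rewrite mulr_suml; apply: ler_sum => i _.
rewrite normrM mulrC ler_wpM2l //; exact: (vj_max i isT).
Qed.

Lemma sum_adj_deg (R : realType) (G : sgraph) (j : 'I_#|G|) :
  \sum_i adj_mx R G i j = (deg (enum_val j))%:R.
Proof.
under eq_bigr do rewrite mxE adj_sym.
rewrite -natr_sum; congr (_%:R).
rewrite -(reindex _ (onW_bij predT (enum_val_bij G))
            (F := fun y => nat_of_bool (adj (enum_val j) y))) /=.
rewrite /deg -sum1_card [RHS]big_mkcond /=.
by apply: eq_bigr => y _; rewrite inE; case: adj.
Qed.

(** As [1 - alpha >= 0], the degree and adjacency parts of a column each
    contribute their coefficient, in absolute value, times the degree. *)
Lemma Balpha_col_sum_le (R : realType) (G : sgraph) (alpha : R) (j : 'I_#|G|) :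
  alpha <= 1 ->
  \sum_i `|Balpha G alpha i j|
    <= (1 - alpha + `|2 * alpha - 1|) * (max_degree G)%:R.
Proof.
move=> alpha_le1; have ? : 0 <= 1 - alpha by rewrite subr_ge0.
set d : R := (deg (enum_val j))%:R.
apply: (@le_trans _ _ ((1 - alpha + `|2 * alpha - 1|) * d)); last first.
  apply: ler_wpM2l; first exact: addr_ge0.
  by rewrite /d ler_nat /max_degree (leq_bigmax (enum_val j)).
have entry i : `|Balpha G alpha i j|
    <= (1 - alpha) * (d *+ (i == j)) + `|2 * alpha - 1| * adj_mx R G i j.
  have -> : Balpha G alpha i j
      = (1 - alpha) * (d *+ (i == j)) + (2 * alpha - 1) * adj_mx R G i j.
    rewrite !mxE; case: eqP => [->|_]; rewrite ?mulr1n ?mulr0n -/d; lra.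
  apply: le_trans (ler_normD _ _) _; rewrite !normrM lerD //.
    by rewrite normrMn !ger0_norm // ler0n.
  by rewrite mxE normr_nat.
apply: le_trans (ler_sum _ (fun i _ => entry i)) _.
rewrite big_split /= -!mulr_sumr sum_adj_deg -/d [leRHS]mulrDl lerD2r.
by rewrite (bigD1 j) //= eqxx big1 ?addr0 // => i /negPf ->.
Qed.

Theorem theorem4p4 (R : realType) (G : sgraph) (hG : connected_graph G)
    (alpha : R) (halpha : 0 <= alpha <= 1) :
  lambda1 (Balpha G alpha) <=
    (if alpha <= 1 / 2 then (2 - 3 * alpha) * (max_degree G)%:R
     else alpha * (max_degree G)%:R).
Proof.
have [G_gt0 _] := hG; have /andP[_ alpha_le1] := halpha.
have [lambda_eig _] := lambda1P G_gt0 (Balpha_sym G alpha).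
have := norm_eigenvalue_le_col_sum _ _ _ _ _
          (fun j => Balpha_col_sum_le _ _ _ j alpha_le1) lambda_eig.
move/(le_trans (ler_norm _)) => bound; apply: le_trans bound _.
case: (lerP alpha (1 / 2)) => alpha_half.
- have -> : 1 - alpha + `|2 * alpha - 1| = 2 - 3 * alpha.
    by rewrite ler0_norm; lra.
  exact: lexx.
- have -> : 1 - alpha + `|2 * alpha - 1| = alpha by rewrite ger0_norm; lra.
  exact: lexx.
Qed.
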